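(* Let $B_1,\dots,B_p$ be real $d\times d$ matrices with $B_i^T+B_i\le 0$ for $i=1,\dots,p$, and let $u$ be an input with fundamental matrix $\Phi_u(t)$, $t\ge 0$. Let $\Phi_u(t)=O(t)S(t)$ be the polar decomposition of $\Phi_u(t)$, where $S(t)$ is symmetric positive definite and $O(t)\in SO_d$. Then: (a) The function $t\mapsto \Phi_u(t)^T\Phi_u(t)=S^2(t)$ converges as $t\to+\infty$ to a limit $S_u^2$, where $S_u$ is a symmetric nonnegative matrix, and $S_u$ is the common value of the (symmetric nonnegative) square roots of $M^TM$ for $M\in\Omega_u$. (b) The $\omega$-limit set $\mathcal{O}_u$ of $\{O(t);\ t\ge 0\}$ is a compact and connected subset of $SO_d$, and $\Omega_u=\{OS_u;\ O\in\mathcal{O}_u\}=\mathcal{O}_uS_u$. (c) The switched system $\dot x=B_{u(t)}x$ is asymptotically stable for the input $u$ if and only if $S_u=0$.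
   Context: For a symmetric matrix $Q$, $Q\le 0$ means $x^TQx\le 0$ for all $x\in\mathbb{R}^d$. An input (switching signal) is a piecewise constant, right-continuous function $u:[0,+\infty[\to\{1,\dots,p\}$, with switching times $(a_n)_{n\ge0}$, $a_0=0$, strictly increasing to $+\infty$; $u$ is constant, equal to $u_n$, on $[a_n,a_{n+1}[$, and $\delta_n=a_{n+1}-a_n$. The switched system is $\dot x=B_{u(t)}x$ in $\mathbb{R}^d$; its solution from $x$ is $t\mapsto\Phi_u(t)x$, where $\Phi_u(t)=\exp((t-a_n)B_{u_n})\exp(\delta_{n-1}B_{u_{n-1}})\cdots\exp(\delta_0B_{u_0})$ for $t\in[a_n,a_{n+1}[$ (so $\det\Phi_u(t)>0$). The $\omega$-limit set of a matrix-valued function on $[0,+\infty[$ is the set of limits of its values along sequences $(t_k)$ strictly increasing to $+\infty$; $\Omega_u$ denotes the $\omega$-limit set of $\{\Phi_u(t);\ t\ge 0\}$ in the space of real $d\times d$ matrices. The system is asymptotically stable for the input $u$ if $\Phi_u(t)x\to0$ as $t\to+\infty$ for every $x\in\mathbb{R}^d$ (note that $\|\Phi_u(t)x\|$ is always nonincreasing in $t$). *)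

(* Defs.v *)
From mathcomp Require Export all_boot all_order all_algebra.
From mathcomp Require Export all_classical all_reals all_analysis.
Export Order.TTheory GRing.Theory Num.Theory.
Export numFieldNormedType.Exports.

Set Implicit Arguments.
Unset Strict Implicit.
Unset Printing Implicit Defensive.

Local Open Scope classical_set_scope.
Local Open Scope ring_scope.

Section Matrices.
Context {R : realType} {d : nat}.
Implicit Types A Q S O : 'M[R]_d.

Definition quad_form Q (x : 'cV[R]_d) : R := (x^T *m Q *m x) 0 0.

Definition symmetric_mx Q : Prop := Q^T = Q.

Definition sym_nonpos Q : Prop :=
  symmetric_mx Q /\ forall x, quad_form Q x <= 0.

Definition sym_nonneg Q : Prop :=
  symmetric_mx Q /\ forall x, 0 <= quad_form Q x.

Definition sym_posdef Q : Prop :=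
  symmetric_mx Q /\ forall x, x != 0 -> 0 < quad_form Q x.

Definition SO : set 'M[R]_d := [set O | O^T *m O = 1%:M /\ \det O = 1].

Definition polar_decomposition A O S : Prop :=
  [/\ A = O *m S, SO O & sym_posdef S].

Definition nonneg_sqrt A S : Prop := sym_nonneg S /\ S *m S = A.

Definition expmx A : 'M[R]_d :=
  limn (series (fun k => (k`!%:R)^-1 *: A ^+ k : 'M[R]_d)).

End Matrices.

Arguments SO {R} d.

Definition omega_limit {R : realType} {T : topologicalType} (f : R -> T) : set T :=
  [set l | exists t : R^nat,
    [/\ forall k, 0 <= t k, forall k, t k < t k.+1,
        t @ \oo --> +oo & f (t k) @[k --> \oo] --> l]].

(* Only the values of the signal on [0, +oo[ matter.  Consecutive modes may
   coincide, so that eventually constant signals are inputs too. *)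
Record input (R : realType) (p : nat) := Input {
  signal :> R -> 'I_p;
  switch_time : R^nat;
  switch_time0 : switch_time 0%N = 0;
  switch_time_lt : forall n, switch_time n < switch_time n.+1;
  switch_time_cvgy : switch_time @ \oo --> +oo;
  signal_cst : forall n t, switch_time n <= t < switch_time n.+1 ->
    signal t = signal (switch_time n)
}.

Section SwitchedSystem.
Context {R : realType} {d p : nat}.
Variables (B : 'I_p -> 'M[R]_d) (u : input R p).

Let a := switch_time u.

Definition mode n : 'I_p := u (a n).

Definition dwell_time n : R := a n.+1 - a n.

Fixpoint fundamental_at_switch n : 'M[R]_d :=
  if n is m.+1 then
    expmx (dwell_time m *: B (mode m)) *m fundamental_at_switch m
  else 1%:M.

(* For 0 <= t there is exactly one such n; the default value is irrelevant. *)
Definition switch_index (t : R) : nat := xget 0%N [set n | a n <= t < a n.+1].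

Definition fundamental_matrix (t : R) : 'M[R]_d :=
  let n := switch_index t in
  expmx ((t - a n) *: B (mode n)) *m fundamental_at_switch n.

Definition asymptotically_stable : Prop :=
  forall x : 'cV[R]_d, fundamental_matrix t *m x @[t --> +oo] --> (0 : 'cV[R]_d).

Lemma switch_index_exists t : 0 <= t -> exists n, a n <= t < a n.+1.
Proof.
move=> t0.
have ex : exists n, t < a n.
  have /cvgryPgt/(_ t) [N _ hN] := switch_time_cvgy u.
  by exists N; exact: hN (leqnn N).
case: (ex_minnP ex) => -[|n] ltn minn.
  by move: ltn; rewrite /a switch_time0 ltNge t0.
exists n; rewrite ltn andbT leNgt; apply/negP => /minn.
by rewrite ltnn.
Qed.

Lemma switch_indexE n t : a n <= t < a n.+1 -> switch_index t = n.
Proof.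
have nd k l : (k <= l)%N -> a k <= a l.
  move=> kl; rewrite -(subnK kl); elim: (l - k)%N => // j ih.
  exact: le_trans ih (ltW (switch_time_lt u _)).
move=> hn; apply: xget_unique => // m /= hm.
have lt k l : a k <= t < a k.+1 -> a l <= t < a l.+1 -> (k <= l)%N.
  move=> /andP[hk _] /andP[_ hl]; rewrite leqNgt; apply/negP => /nd.
  by rewrite leNgt (le_lt_trans hk hl).
by apply/eqP; rewrite eqn_leq !lt.
Qed.

Lemma fundamental_matrixE n t : a n <= t < a n.+1 ->
  fundamental_matrix t =
    expmx ((t - a n) *: B (mode n)) *m fundamental_at_switch n.
Proof. by move=> /switch_indexE h; rewrite /fundamental_matrix h. Qed.

End SwitchedSystem.

(* Main.v *)
Require Import Defs.
From mathcomp Require Import ring.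

Set Implicit Arguments.
Unset Strict Implicit.
Unset Printing Implicit Defensive.

Local Open Scope classical_set_scope.
Local Open Scope ring_scope.

(** Each flow exp(tB) with B^T + B <= 0 contracts the Euclidean norm, because
    d/dt |y|^2 = y^T (B^T + B) y along y' = By.  Hence for every x the function
    |Phi(t) x|^2 = x^T Phi(t)^T Phi(t) x is nonincreasing and bounded below, so it
    converges; by polarization every entry of the Gram matrix
    Phi(t)^T Phi(t) = S(t)^2 converges, to some L ([gram_cvg]).

    Taking square roots of nonnegative symmetric matrices is continuous, and this
    needs no spectral theorem: the matrices S(t) are bounded since their squares
    are, each of their accumulation points is a nonnegative square root of L, and
    there is at most one such root ([psd_sqrt_unique]).  So S(t) converges to the
    root S_u of L, whose existence is obtained along the way ([psd_sqrt_cvg]).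

    The rest is compactness of SO_d.  Along any ultrafilter going to infinity O(t)
    has a limit Q, and then Phi(t) = O(t) S(t) tends to Q S_u; as limits along
    such ultrafilters are exactly the omega-limit points, the omega-limit set of
    Phi is O_u S_u, and (Q S_u)^T (Q S_u) = S_u^2.  The same compactness argument
    shows that O is continuous, because S(t) is invertible and determines O(t)
    ([polar_factor_continuous]); the omega-limit set of a continuous curve with
    values in a compact set is connected ([connected_cluster]).  Stability is the
    statement that Phi(t) tends to 0, that is L = 0, that is S_u = 0. *)

(** * Convergence along ultrafilters, cluster points and omega-limits *)

Lemma ultra_fmap (I J : Type) (f : I -> J) (F : set_system I) :
  UltraFilter F -> UltraFilter (f @ F).
Proof.
move=> UF; split; first exact: fmap_proper_filter.
move=> G PG FG; apply/seteqP; split=> A; last exact: FG.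
move=> GA; have [//|FnA] := in_ultra_setVsetC (f @^-1` A) UF.
have GnA : G (~` A) by exact: FG.
by have /filter_ex[x []] : G (A `&` ~` A) by exact: filterI.
Qed.

Lemma ultra_cvg (I : Type) (T : topologicalType) (G : set_system I) (f : I -> T)
    (K : set T) :
  UltraFilter G -> compact K -> (\forall t \near G, K (f t)) ->
  exists2 l, K l & f @ G --> l.
Proof.
move=> UG + GK; rewrite compact_ultra => cK.
by have [l [Kl fl]] := cK (f @ G) (@ultra_fmap _ _ f G UG) GK; exists l.
Qed.

Lemma cvg_ultra (I : Type) (T : topologicalType) (F : set_system I) (f : I -> T)
    (l : T) :
  Filter F -> (forall G, UltraFilter G -> F `<=` G -> f @ G --> l) -> f @ F --> l.
Proof.
move=> FF fl W lW; apply: contrapT => nFW.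
have PH : ProperFilter (within (~` (f @^-1` W)) F).
  split; last exact: within_filter.
  by rewrite /within/= => h; apply: nFW; apply: filterS h => t /=;
  exact: contrapT.
have [G [UG HG]] := ultraFilterLemma PH.
have GW : G (f @^-1` W).
  apply: (fl G UG _ W lW) => A FA; apply: HG.
  by rewrite /within/=; apply: filterS FA => t.
have GnW : G (~` (f @^-1` W)) by apply: HG; exact: withinT.
by have /filter_ex[t []] : G (f @^-1` W `&` ~` (f @^-1` W)) by exact: filterI.
Qed.

(** In a compact set convergence follows from uniqueness of the limits along
    finer ultrafilters; all continuity statements for polar factors come from
    here. *)
Lemma cvg_compact (I : Type) (T : topologicalType) (F : set_system I)
    (f : I -> T) (K : set T) (l : T) :
  Filter F -> compact K -> (\forall t \near F, K (f t)) ->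
  (forall G, UltraFilter G -> F `<=` G -> forall x, f @ G --> x -> x = l) ->
  f @ F --> l.
Proof.
move=> FF cK FK uniq; apply: cvg_ultra => G UG FG.
have [x _ fx] := ultra_cvg UG cK (FG _ FK).
by rewrite -(uniq G UG FG x fx).
Qed.

(** Otherwise the complement of W would meet every element of F, and
    compactness of its trace on K would give a cluster point outside W. *)
Lemma cluster_near (T : topologicalType) (F : set_system T) (K W : set T) :
  ProperFilter F -> compact K -> F K -> open W -> cluster F `<=` W -> F W.
Proof.
move=> PF cK FK oW clW; apply: contrapT => nFW.
have PG : ProperFilter (within (~` W) F).
  split; last exact: within_filter.
  by rewrite /within/= => h; apply: nFW; apply: filterS h => x /=;
  exact: contrapT.
have cKW : compact (K `&` ~` W).
  by apply: compact_closedI => //; exact: open_closedC.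
have GKW : within (~` W) F (K `&` ~` W) by apply: filterS FK => x.
have [x [[_ nWx] clx]] := cKW _ PG GKW; apply: nWx; apply: clW.
apply: cvg_cluster clx; exact: cvg_within.
Qed.

Lemma cvg_sub_cluster (I : Type) (T : topologicalType) (F G : set_system I)
    (f : I -> T) (l : T) :
  ProperFilter G -> F `<=` G -> f @ G --> l -> cluster (f @ F) l.
Proof.
move=> PG FG fl A C fA lC.
have : G (f @^-1` (A `&` C)) by apply: filterI; [exact: FG|exact: fl].
by move=> /filter_ex[t]; exists (f t).
Qed.

Lemma closed_cluster (T : topologicalType) (F : set_system T) :
  closed (cluster F).
Proof. by rewrite clusterE; apply: closed_bigI => A _; exact: closed_closure. Qed.

(** If the cluster set split into two parts, these would be closed and disjoint,
    hence contained in disjoint open sets U and V by normality.  By compactness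
    f stays eventually in the union of U and V, thus, being continuous, in one of
    them; but then the other part contains no cluster point. *)
Lemma connected_cluster (R : realType) (T : pseudoMetricType R) (f : R -> T)
    (K : set T) :
  compact K -> (forall t, 0 < t -> K (f t)) ->
  (forall t, 0 < t -> {for t, continuous f}) ->
  connected (cluster (f @ +oo)).
Proof.
move=> cK fK cf; apply: contrapT => /connectedPn[E [E0 EU [sE1 sE2]]].
have clE b : closed (E b).
  move=> x clx; have : cluster (f @ +oo) x.
    apply: closed_cluster; apply: closureS clx; rewrite EU.
    by case: b => y Ey; [right|left].
  rewrite EU; case: b clx => clx [] // Ex.
    by have : (E false `&` closure (E true)) x by []; rewrite sE2.
  by have : (closure (E false) `&` E true) x by []; rewrite sE1.
have E01 : E false `&` E true = set0.
  by rewrite -subset0 -sE1; apply: setSI; exact: subset_closure.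
have [U [V [oU oV EfU EtV UV0]]] := (@normal_openP R T).1
  pseudometric_normal _ _ (clE false) (clE true) E01.
have nK : \forall t \near +oo, K (f t).
  by near=> t; apply: fK; near: t; apply: nbhs_pinfty_gt; exact: num_real.
have UV : (f @ +oo) (U `|` V).
  apply: (@cluster_near _ (f @ +oo) K _ _ cK nK (openU oU oV)).
  by rewrite EU; exact: setUSS.
have [M /= [Mr fM]] := UV.
pose M' := Num.max M 0.
have cI : connected (f @` `]M', +oo[).
  apply: connected_continuous_connected.
    by apply/connected_intervalP; exact: interval_is_interval.
  apply: continuous_in_subspaceT => t; rewrite inE/= in_itv/= andbT => M't.
  by apply: cf; apply: le_lt_trans M't; rewrite le_max lexx orbT.
(* each of the two parts is visited by f at arbitrarily large times *)
have disj X (x : T) b : f @` `]M', +oo[ `<=` X -> E b x ->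
    forall Y, open Y -> Y x -> X `&` Y = set0 -> False.
  move=> fX Ex Y oY Yx XY.
  have clx : cluster (f @ +oo) x by rewrite EU; case: b Ex; [right|left].
  have nX : \forall t \near +oo, X (f t).
    near=> t; apply: fX; exists t => //=; rewrite in_itv/= andbT.
    by near: t; apply: nbhs_pinfty_gt; exact: num_real.
  have [y [Xy Yy]] := clx X Y nX (open_nbhs_nbhs (conj oY Yx)).
  by have : (X `&` Y) y by []; rewrite XY.
have [x0 x0E] := E0 false; have [x1 x1E] := E0 true.
have open_sep (X Y : set T) : open Y -> X `&` Y = set0 -> closure X `&` Y = set0.
  move=> oY XY; apply/disjoints_subset.
  rewrite (closure_id (~` Y)).1; last exact: open_closedC.
  exact/closureS/disjoints_subset.
have sUV : separated U V.
  by split; [|rewrite setIC]; apply: open_sep; rewrite // setIC.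
have fUV : f @` `]M', +oo[ `<=` U `|` V.
  move=> _ [t /= + <-]; rewrite in_itv/= andbT => M't; apply: fM.
  by apply: le_lt_trans M't; rewrite le_max lexx.
have [fX|fX] := connected_subset sUV fUV cI.
  exact: (disj _ _ _ fX x1E _ oV (EtV _ x1E) UV0).
by apply: (disj _ _ _ fX x0E _ oU (EfU _ x0E)); rewrite setIC.
Unshelve. all: by end_near. Qed.

Lemma omega_limit_ultra (R : realType) (T : topologicalType) (f : R -> T) (l : T) :
  omega_limit f l ->
  exists2 G, UltraFilter G & (+oo : set_system R) `<=` G /\ f @ G --> l.
Proof.
move=> [t [_ _ too fl]].
have [G [UG tG]] := ultraFilterLemma (fmap_proper_filter t eventually_filter).
exists G => //; split=> A hA; apply: tG.
  exact: too.
exact: fl.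
Qed.

(** The topology being first countable, a cluster point is reached along a
    sequence of times; requiring each time to exceed the previous one by at least
    1 makes the sequence strictly increasing and unbounded. *)
Lemma omega_limitE (R : realType) (T : pseudoMetricType R) (f : R -> T) :
  omega_limit f = cluster (f @ +oo).
Proof.
apply/seteqP; split=> l.
  by move=> /omega_limit_ultra[G UG [ooG fl]]; exact: cvg_sub_cluster ooG fl.
move=> cl.
have next (k : nat) (s : R) : exists t, s + 1 < t /\ ball l k.+1%:R^-1 (f t).
  have nf : \forall t \near +oo, (f @` [set t | s + 1 < t]) (f t).
    by near=> t; exists t => //=; near: t; apply: nbhs_pinfty_gt; exact: num_real.
  have nl : nbhs l (ball l k.+1%:R^-1) by apply: nbhsx_ballx; rewrite invr_gt0.
  have [y [[t st ft] By]] := cl (f @` [set t | s + 1 < t]) (ball l k.+1%:R^-1) nf nl.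
  by exists t; rewrite ft.
have [n nP] := choice (fun ks => next ks.1 ks.2).
pose t := fix t k := n (k, if k is j.+1 then t j else 0).
have tS k : t k + 1 < t k.+1 by case: (nP (k.+1, t k)).
have tB k : ball l k.+1%:R^-1 (f (t k)).
  by case: k => [|k]; [case: (nP (0%N, 0))|case: (nP (k.+1, t k))].
have tk k : k%:R < t k.
  elim: k => [|k ih]; first by have [+ _] := nP (0%N, 0); apply: lt_trans; rewrite add0r.
  by apply: lt_trans (tS k); rewrite -natr1 ltrD2r.
exists t; split.
- by move=> k; apply: ltW; apply: le_lt_trans (tk k); rewrite ler0n.
- by move=> k; apply: lt_trans (tS k); rewrite ltrDl.
- apply: ger_cvgy; last exact: cvgr_idn.
  by near=> k; exact/ltW/tk.
- apply/cvg_ballP => e e0; near=> k.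
  suff ke : k.+1%:R^-1 <= e by exact: le_ball ke _ (tB k).
  by apply: ltW; near: k; exact: (near_infty_natSinv_lt (PosNum e0)).
Unshelve. all: by end_near. Qed.

(** * Topology of matrices *)

Lemma cvg_mxP (R : realType) (I : Type) (F : set_system I) {FF : Filter F}
    (m n : nat) (f : I -> 'M[R]_(m, n)) (M : 'M[R]_(m, n)) :
  f @ F --> M <-> forall i j, f t i j @[t --> F] --> M i j.
Proof.
split=> [fM i j|fM].
  exact: (continuous_cvg FF (@coord_continuous R m n i j M) fM).
apply/cvg_ballP => e e0; near=> t; split=> //.
near: t.
apply: filter_forall => i; apply: filter_forall => j.
exact: (cvg_ball (fM i j)).
Unshelve. all: by end_near. Qed.

Lemma cvg_mulmx (R : realType) (I : Type) (F : set_system I) {FF : Filter F}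
    (m n p : nat) (f : I -> 'M[R]_(m, n)) (g : I -> 'M[R]_(n, p))
    (M : 'M[R]_(m, n)) (N : 'M[R]_(n, p)) :
  f @ F --> M -> g @ F --> N -> f t *m g t @[t --> F] --> M *m N.
Proof.
move=> /cvg_mxP fM /cvg_mxP gN; apply/cvg_mxP => i j; rewrite mxE.
under eq_cvg do rewrite mxE.
by apply: cvg_big => [|k _]; [exact: add_continuous|exact: cvgM].
Qed.

Lemma cvg_trmx (R : realType) (I : Type) (F : set_system I) {FF : Filter F}
    (m n : nat) (f : I -> 'M[R]_(m, n)) (M : 'M[R]_(m, n)) :
  f @ F --> M -> (f t)^T @[t --> F] --> M^T.
Proof.
move=> /cvg_mxP fM; apply/cvg_mxP => i j; rewrite mxE.
by under eq_cvg do rewrite mxE; exact: fM.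
Qed.

Lemma cvg_det (R : realType) (I : Type) (F : set_system I) {FF : Filter F}
    (n : nat) (f : I -> 'M[R]_n) (M : 'M[R]_n) :
  f @ F --> M -> \det (f t) @[t --> F] --> \det M.
Proof.
move=> /cvg_mxP fM; apply: cvg_big => [|s _]; first exact: add_continuous.
apply: cvgM; first exact: cvg_cst.
by apply: cvg_big => [|i _]; [exact: mul_continuous|].
Qed.

Lemma mx_cvg_unique (R : realType) (I : Type) (F : set_system I) {FF : ProperFilter F}
    (m n : nat) (f : I -> 'M[R]_(m, n)) (M N : 'M[R]_(m, n)) :
  f @ F --> M -> f @ F --> N -> M = N.
Proof. by apply: cvg_unique; exact: norm_hausdorff. Qed.

Definition mx_box (R : realType) (m n : nat) (c : R) : set 'M[R]_(m, n) :=
  [set M | forall i j, `|M i j| <= c].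

Lemma compact_mx_box (R : realType) (m n : nat) (c : R) :
  compact (@mx_box R m n c).
Proof.
rewrite compact_ultra => F UF FB.
have lim i j : exists x : R, M i j @[M --> F] --> x /\ `|x| <= c.
  have [|x] := @ultra_cvg _ _ F (fun M : 'M[R]_(m, n) => M i j) _ UF
    (@segment_compact R (- c) c).
    by apply: filterS FB => M /(_ i j); rewrite /= in_itv/= ler_norml.
  by rewrite /= in_itv/= -ler_norml; exists x.
have [L LP] := choice (fun ij => lim ij.1 ij.2).
exists (\matrix_(i, j) L (i, j)); split.
  by move=> i j; rewrite mxE; case: (LP (i, j)).
apply: (@cvg_mxP R _ F _ m n id _).2 => i j; rewrite mxE; exact: (LP (i, j)).1.
Qed.

(** This is what turns convergence of a Gram matrix, or of the square of a
    symmetric matrix, into boundedness of the matrix itself. *)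
Lemma entry_sqr_le_gram (R : realType) (m n : nat) (A : 'M[R]_(m, n)) i j :
  A i j ^+ 2 <= (A^T *m A) j j.
Proof.
rewrite mxE (bigD1 i)//= mxE -expr2 lerDl; apply: sumr_ge0 => k _.
by rewrite mxE -expr2 sqr_ge0.
Qed.

Lemma SO_box (R : realType) (n : nat) : @SO R n `<=` mx_box 1.
Proof.
move=> Q [QQ _] i j; have := entry_sqr_le_gram Q i j.
by rewrite QQ mxE eqxx -[leRHS](expr1n _ 2) -real_normK ?num_real// ler_sqr ?nnegrE.
Qed.

Lemma closed_SO_cvg (R : realType) (n : nat) (I : Type) (F : set_system I)
    {PF : ProperFilter F} (O : I -> 'M[R]_n) (Q : 'M[R]_n) :
  (\forall t \near F, SO n (O t)) -> O @ F --> Q -> SO n Q.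
Proof.
move=> SOO OQ; split.
  apply: (@mx_cvg_unique _ _ F _ _ _ (fun t => (O t)^T *m O t)).
    by apply: cvg_mulmx => //; exact: cvg_trmx.
  apply: cvg_near_cst; apply: filterS SOO => t [-> //].
apply: (cvg_unique (@Rhausdorff R) (cvg_det OQ)).
by apply: cvg_near_cst; apply: filterS SOO => t [_ ->].
Qed.

Lemma compact_SO (R : realType) (n : nat) : compact (@SO R n).
Proof.
rewrite compact_ultra => F UF FSO.
have [|Q _ FQ] := @ultra_cvg _ _ F id _ UF (@compact_mx_box R n n 1).
  by apply: filterS FSO; exact: SO_box.
exists Q; split => //; exact: (@closed_SO_cvg _ _ _ F _ id).
Qed.

(** * Nonnegative symmetric matrices and their square roots *)

Section Quadratic.
Context {R : realType} {d : nat}.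
Implicit Types A Q S T D : 'M[R]_d.

Lemma norm_col_ge0 (x : 'cV[R]_d) : 0 <= (x^T *m x) 0 0.
Proof. by rewrite mxE; apply: sumr_ge0 => k _; rewrite mxE -expr2 sqr_ge0. Qed.

Lemma norm_col_eq0 (x : 'cV[R]_d) : (x^T *m x) 0 0 = 0 -> x = 0.
Proof.
move=> x0; apply/matrixP => i j; rewrite [j]ord1 mxE; apply/eqP.
rewrite -sqrf_eq0 eq_le sqr_ge0 andbT -x0; exact: entry_sqr_le_gram.
Qed.

Lemma quad_form_gram (M : 'M[R]_d) (x : 'cV[R]_d) :
  quad_form (M^T *m M) x = ((M *m x)^T *m (M *m x)) 0 0.
Proof. by rewrite /quad_form trmx_mul !mulmxA. Qed.

Lemma quad_formD Q (x y : 'cV[R]_d) :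
  quad_form Q (x + y) =
  quad_form Q x + quad_form Q y + (x^T *m Q *m y + y^T *m Q *m x) 0 0.
Proof.
rewrite /quad_form [(x + y)^T]linearD/= !mulmxDl !mulmxDr.
move: (x^T *m Q *m x) (y^T *m Q *m y) (x^T *m Q *m y) (y^T *m Q *m x).
by move=> a b c e; rewrite !mxE; ring.
Qed.

Lemma quad_formZ Q c (x : 'cV[R]_d) :
  quad_form Q (c *: x) = c ^+ 2 * quad_form Q x.
Proof.
by rewrite /quad_form [(c *: x)^T]linearZ/= -!scalemxAl -scalemxAr !mxE mulrA.
Qed.

(** With y = Sx, nonnegativity of the form at x + c y reads
    0 <= 2 c |y|^2 + c^2 (y^T S y) for all c, which forces y = 0. *)
Lemma quad_form0_mul S (x : 'cV[R]_d) :
  sym_nonneg S -> quad_form S x = 0 -> S *m x = 0.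
Proof.
move=> [Ssym Sge0] qx0; pose y := S *m x; apply: norm_col_eq0; rewrite -/y.
have yT : y^T = x^T *m S by rewrite /y trmx_mul Ssym.
set s := (y^T *m y) 0 0; set q := quad_form S y.
have s0 : 0 <= s by exact: norm_col_ge0.
have q0 : 0 <= q by exact: Sge0.
have qxc c : 0 <= c ^+ 2 * q + c * s *+ 2.
  have := Sge0 (x + c *: y).
  rewrite quad_formD quad_formZ qx0 add0r [(c *: y)^T]linearZ/= -scalemxAl -scalemxAr.
  rewrite -yT -scalemxAl -mulmxA -/y -scalerDr.
  by rewrite mxE [(y^T *m y + _) _ _]mxE -/s -mulr2n mulrnAr.
(* a negative c, small enough for the linear term to win; q + 1 avoids q = 0 *)
have := qxc (- s / (q + 1)).
have q1 : 0 < q + 1 by rewrite ltr_wpDl.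
have -> : (- s / (q + 1)) ^+ 2 * q + - s / (q + 1) * s *+ 2 =
    - (s ^+ 2 * (q + 2)) / (q + 1) ^+ 2.
  by field; rewrite gt_eqF.
rewrite mulNr oppr_ge0 pmulr_lle0 ?invr_gt0 ?exprn_gt0//.
rewrite pmulr_lle0; last by rewrite ltr_wpDl.
by move=> s2; apply/eqP; rewrite -sqrf_eq0 eq_le s2 sqr_ge0.
Qed.

Lemma conj_mx_diag S D i :
  (D^T *m S *m D) i i = quad_form S (col i D).
Proof.
rewrite /quad_form tr_col -row_mul.
by rewrite !mxE; apply: eq_bigr => j _; rewrite !mxE.
Qed.

Lemma tr_conj_ge0 S D : sym_nonneg S -> 0 <= \tr (D^T *m S *m D).
Proof. by move=> [_ S0]; apply: sumr_ge0 => i _; rewrite conj_mx_diag. Qed.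

Lemma tr_conj_eq0 S D : sym_nonneg S -> \tr (D^T *m S *m D) = 0 -> S *m D = 0.
Proof.
move=> Spsd tr0.
have /psumr_eq0P diag0 : forall i, true -> 0 <= (D^T *m S *m D) i i.
  by move=> i _; rewrite conj_mx_diag; exact: Spsd.2.
apply/matrixP => i j.
have := quad_form0_mul Spsd (etrans (esym (conj_mx_diag S D j)) (diag0 tr0 j isT)).
move=> /matrixP/(_ i 0); rewrite [RHS]mxE => Sij; rewrite [RHS]mxE -Sij !mxE.
by apply: eq_bigr => k _; rewrite !mxE.
Qed.

(** The difference D = S - T satisfies SD + DT = S^2 - T^2 = 0.  Multiplying by D
    and taking traces, tr (DSD) + tr (DTD) = 0 with both terms nonnegative, so
    SD = TD = 0 and D^2 = 0. *)
Lemma psd_sqrt_unique S T :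
  sym_nonneg S -> sym_nonneg T -> S *m S = T *m T -> S = T.
Proof.
move=> Sp Tp ST; pose D := S - T.
have DT : D^T = D by rewrite /D linearB/= Sp.1 Tp.1.
have SDT : S *m D + D *m T = 0.
  by rewrite /D mulmxBr mulmxBl ST addrA subrK subrr.
have tr0 : \tr (D^T *m S *m D) + \tr (D^T *m T *m D) = 0.
  rewrite DT -mulmxA [\tr (D *m T *m D)]mxtrace_mulC -linearD -mulmxDr.
  by rewrite SDT mulmx0 linear0.
have S0 := tr_conj_ge0 D Sp; have T0 := tr_conj_ge0 D Tp.
have SD0 : S *m D = 0.
  apply: tr_conj_eq0 => //; apply/eqP; rewrite eq_le S0 andbT -tr0 lerDl//.
have TD0 : T *m D = 0.
  apply: tr_conj_eq0 => //; apply/eqP; rewrite eq_le T0 andbT -tr0 lerDr//.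
have DD : D *m D = 0 by rewrite {1}/D mulmxBl SD0 TD0 subrr.
apply/subr0_eq; rewrite -/D; apply/matrixP => i j; rewrite [RHS]mxE; apply/eqP.
have := entry_sqr_le_gram D i j; rewrite DT DD [leRHS]mxE => Dij.
by rewrite -sqrf_eq0 eq_le Dij sqr_ge0.
Qed.

End Quadratic.

Section SqrtLimits.
Context {R : realType} {d : nat}.
Implicit Types A Q S T D : 'M[R]_d.

Lemma posdef_nonneg S : sym_posdef S -> sym_nonneg S.
Proof.
move=> [Ssym S0]; split=> // x; have [->|x0] := eqVneq x 0; last exact/ltW/S0.
by rewrite /quad_form mulmx0 mxE.
Qed.

(** A nonzero row r of D would give r S r^T = 0. *)
Lemma posdef_mul0 S D : sym_posdef S -> D *m S = 0 -> D = 0.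
Proof.
move=> [_ S0] DS; apply/row_matrixP => i; rewrite row0; apply/eqP.
rewrite -[_ == _]negbK; apply/negP => ri.
have := S0 (row i D)^T; rewrite /quad_form trmxK -row_mul DS row0 mul0mx mxE ltxx.
by rewrite trmx_eq0 => /(_ ri).
Qed.

Lemma sym_nonneg_cvg (I : Type) (F : set_system I) {PF : ProperFilter F}
    (S : I -> 'M[R]_d) (X : 'M[R]_d) :
  (\forall t \near F, sym_nonneg (S t)) -> S @ F --> X -> sym_nonneg X.
Proof.
move=> Spsd SX; split.
  apply: (@mx_cvg_unique _ _ F _ _ _ (fun t => (S t)^T)); first exact: cvg_trmx.
  apply: cvg_trans SX; apply: near_eq_cvg.
  by apply: filterS Spsd => t [].
move=> x; apply: (@cvgr_to_ge _ F _ R (fun t => quad_form (S t) x) (quad_form X x) 0).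
  have xSx : (x^T *m S t *m x) @[t --> F] --> x^T *m X *m x.
    by apply: cvg_mulmx; [apply: cvg_mulmx => //|]; exact: cvg_cst.
  exact: ((cvg_mxP _ _).1 xSx 0 0).
by apply: filterS Spsd => t [_].
Qed.

(** Existence of a square root of L comes for free: it is the limit of S along
    any ultrafilter finer than F, which exists because S is bounded. *)
Lemma psd_sqrt_cvg (I : Type) (F : set_system I) {PF : ProperFilter F}
    (S : I -> 'M[R]_d) (L : 'M[R]_d) :
  (\forall t \near F, sym_nonneg (S t)) -> S t *m S t @[t --> F] --> L ->
  exists T, [/\ sym_nonneg T, T *m T = L & S @ F --> T].
Proof.
move=> Spsd SSL; pose c := 1 + \sum_j `|L j j|.
have Lc j : L j j < c.
  rewrite /c (bigD1 j)//=; apply: le_lt_trans (ler_norm _) _.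
  rewrite addrCA ltrDl ltr_pwDl//; exact: sumr_ge0.
have c1 : 1 <= c by rewrite lerDl; exact: sumr_ge0.
have SSc : \forall t \near F, forall j, (S t *m S t) j j <= c.
  apply: filter_forall => j.
  by apply: cvgr_le (Lc j); exact: ((cvg_mxP _ _).1 SSL j j).
have Sbox : \forall t \near F, @mx_box R d d c (S t).
  apply: filterS2 Spsd SSc => t [Ssym _] SSct i j.
  have := entry_sqr_le_gram (S t) i j; rewrite Ssym => Sij.
  rewrite -ler_sqr ?nnegrE// ?(le_trans _ c1)// real_normK ?num_real//.
  by apply: le_trans Sij (le_trans (SSct j) _); rewrite expr2 ler_peMl// (le_trans _ c1).
have limP G (UG : UltraFilter G) (FG : F `<=` G) (X : 'M[R]_d) :
    S @ G --> X -> sym_nonneg X /\ X *m X = L.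
  move=> SX; split; first exact: (sym_nonneg_cvg (FG _ Spsd) SX).
  apply: (@mx_cvg_unique _ _ G _ _ _ (fun t => S t *m S t)).
    exact: cvg_mulmx.
  exact: cvg_trans (cvg_app _ FG) SSL.
have [G [UG FG]] := ultraFilterLemma PF.
have [T _ ST] := ultra_cvg UG (@compact_mx_box R d d c) (FG _ Sbox).
have [Tpsd TT] := limP _ UG FG T ST; exists T; split=> //.
apply: (@cvg_compact _ _ F S _ T _ (@compact_mx_box R d d c) Sbox) => G' UG' FG' X SX.
by have [Xpsd XX] := limP _ UG' FG' X SX; apply: psd_sqrt_unique => //; rewrite XX.
Qed.

Lemma polar_gram (M O S : 'M[R]_d) :
  polar_decomposition M O S -> M^T *m M = S *m S.
Proof.
by move=> [-> [OO _] [Ssym _]]; rewrite trmx_mul Ssym -mulmxA (mulmxA O^T) OO mul1mx.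
Qed.

Lemma polar_sqrt_continuous (T : topologicalType) (M O S : T -> 'M[R]_d) t :
  (\forall s \near t, polar_decomposition (M s) (O s) (S s)) ->
  {for t, continuous M} -> {for t, continuous S}.
Proof.
move=> MOS cM.
have Spsd : \forall s \near t, sym_nonneg (S s).
  by apply: filterS MOS => s [_ _ /posdef_nonneg].
have SS : S s *m S s @[s --> t] --> S t *m S t.
  rewrite -(polar_gram (nbhs_singleton MOS)).
  apply: cvg_trans (cvg_mulmx (cvg_trmx cM) cM); apply: near_eq_cvg.
  by apply: filterS MOS => s /polar_gram.
have [X [Xpsd XX SX]] := psd_sqrt_cvg Spsd SS.
have XS : X = S t.
  apply: psd_sqrt_unique XX => //; exact: (nbhs_singleton Spsd).
by move: SX; rewrite XS.
Qed.

(** Any limit Q of O along an ultrafilter converging to t satisfies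
    Q S(t) = M(t) = O(t) S(t), and S(t) can be cancelled. *)
Lemma polar_factor_continuous (T : topologicalType) (M O S : T -> 'M[R]_d) t :
  (\forall s \near t, polar_decomposition (M s) (O s) (S s)) ->
  {for t, continuous M} -> {for t, continuous O}.
Proof.
move=> MOS cM; have cS := polar_sqrt_continuous MOS cM.
have OSO : \forall s \near t, SO d (O s) by apply: filterS MOS => s [].
apply: (@cvg_compact _ _ (nbhs t) O _ (O t) _ (@compact_SO R d) OSO).
move=> G UG tG Q OQ.
have MQ : M @ G --> Q *m S t.
  apply: cvg_trans (cvg_mulmx OQ (cvg_trans (cvg_app S tG) cS)).
  by apply: near_eq_cvg; apply: tG; apply: filterS MOS => s [].
have QM : Q *m S t = M t.
  exact: (mx_cvg_unique MQ (cvg_trans (cvg_app M tG) cM)).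
have [MtOS _ Stpos] := nbhs_singleton MOS.
apply/subr0_eq/(posdef_mul0 Stpos).
by rewrite mulmxBl QM MtOS subrr.
Qed.

End SqrtLimits.

(** * The matrix exponential *)

Section Exponential.
Context {R : realType} {d : nat}.
Variable B : 'M[R]_d.
Implicit Types C : 'M[R]_d.

(** The entries of C exp(tB) are power series in t with these coefficients.  The
    left factor C makes the family stable under termwise differentiation, which
    replaces C by CB. *)
Definition expmx_coef C (i j : 'I_d) : R^nat :=
  fun k => (k`!%:R)^-1 * (C *m B ^+ k) i j.

Lemma pseries_diffs_expmx_coef C i j :
  pseries_diffs (expmx_coef C i j) = expmx_coef (C *m B) i j.
Proof.
apply/funext => k; rewrite /pseries_diffs /expmx_coef exprS mulmxA factS natrM invfM.
by rewrite !mulrA mulfV ?mul1r// pnatr_eq0.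
Qed.

Lemma entry_expr_le k i j : `|(B ^+ k) i j| <= (\sum_i \sum_l `|B i l|) ^+ k.
Proof.
set M := \sum_i _; have M0 : 0 <= M by apply: sumr_ge0 => ? _; exact: sumr_ge0.
elim: k i j => [|k ih] i j.
  rewrite !expr0 (_ : 1 = 1%:M :> 'M[R]_d)// mxE.
  by case: (i == j); rewrite ?normr1 ?normr0.
rewrite !exprS mxE; apply: le_trans (ler_norm_sum _ _ _) _.
apply: (@le_trans _ _ (\sum_l `|B i l| * M ^+ k)).
  by apply: ler_sum => l _; rewrite normrM ler_wpM2l.
rewrite -mulr_suml ler_wpM2r ?exprn_ge0// /M [leRHS](bigD1 i)//= lerDl.
by apply: sumr_ge0 => ? _; exact: sumr_ge0.
Qed.

(** Domination by the exponential series at M |x|, where M is the sum of the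
    absolute values of the entries of B. *)
Lemma is_cvg_expmx_coef C i j x : cvgn (pseries (expmx_coef C i j) x).
Proof.
set M := \sum_i \sum_l `|B i l|.
have M0 : 0 <= M by apply: sumr_ge0 => ? _; exact: sumr_ge0.
set N := \sum_l `|C i l|.
apply: normed_cvg.
apply: (@series_le_cvg _ _ (N *: exp_coeff (M * `|x|))).
- by move=> k; exact: normr_ge0.
- by move=> k; apply: mulr_ge0; [exact: sumr_ge0|apply: exp_coeff_ge0; exact: mulr_ge0].
- move=> k; rewrite -[leRHS]/(N * ((M * `|x|) ^+ k / k`!%:R)).
  rewrite /expmx_coef/= !normrM normfV normrX.
  rewrite [`|k`!%:R|]ger0_norm// exprMn.
  have CB : `|(C *m B ^+ k) i j| <= N * M ^+ k.
    rewrite mxE mulr_suml; apply: le_trans (ler_norm_sum _ _ _) _.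
    by apply: ler_sum => l _; rewrite normrM ler_wpM2l// entry_expr_le.
  have -> : N * (M ^+ k * `|x| ^+ k / k`!%:R) =
     k`!%:R^-1 * (N * M ^+ k) * `|x| ^+ k by ring.
  by rewrite ler_wpM2r ?exprn_ge0// ler_wpM2l ?invr_ge0.
- by apply: is_cvg_seriesZ; exact: is_cvg_series_exp_coeff.
Qed.

Lemma exprZ_mx (t : R) k : (t *: B) ^+ k = t ^+ k *: B ^+ k :> 'M[R]_d.
Proof.
elim: k => [|k ih]; first by rewrite !expr0 scale1r.
by rewrite !exprS ih -[LHS]scalemxAl -[X in _ *: X]scalemxAr scalerA.
Qed.

Lemma mul_series_expmx C t n i j :
  (C *m series (fun k => (k`!%:R)^-1 *: (t *: B) ^+ k : 'M[R]_d) n) i j =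
  pseries (expmx_coef C i j) t n.
Proof.
rewrite /pseries /series/= mulmx_sumr summxE; apply: eq_bigr => k _.
by rewrite exprZ_mx -!scalemxAr scalerA mxE /expmx_coef; ring.
Qed.

Lemma cvg_expmx t :
  series (fun k => (k`!%:R)^-1 *: (t *: B) ^+ k : 'M[R]_d) @ \oo -->
  expmx (t *: B).
Proof.
apply/cvg_ex; exists (\matrix_(i, j) limn (pseries (expmx_coef 1%:M i j) t)).
apply/cvg_mxP => i j; rewrite mxE.
under eq_cvg do rewrite -[series _ _]mul1mx mul_series_expmx.
exact: is_cvg_expmx_coef.
Qed.

Lemma mul_expmxE C t i j :
  (C *m expmx (t *: B)) i j = limn (pseries (expmx_coef C i j) t).
Proof.
apply/esym/cvg_lim; first exact: Rhausdorff.
pose e n := series (fun k => (k`!%:R)^-1 *: (t *: B) ^+ k : 'M[R]_d) n.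
have /cvg_mxP/(_ i j) : C *m e n @[n --> \oo] --> C *m expmx (t *: B).
  by apply: cvg_mulmx; [exact: cvg_cst|exact: cvg_expmx].
by under eq_cvg do rewrite mul_series_expmx; apply.
Qed.

Lemma is_derive_mul_expmx C t i j :
  is_derive t (1 : R) (fun s => (C *m expmx (s *: B)) i j)
    ((C *m B *m expmx (t *: B)) i j).
Proof.
rewrite mul_expmxE -pseries_diffs_expmx_coef.
under eq_fun do rewrite mul_expmxE.
apply: (@pseries_snd_diffs _ _ (`|t| + 1)); rewrite ?pseries_diffs_expmx_coef;
  try exact: is_cvg_expmx_coef.
by rewrite [ltRHS]ger0_norm ?addr_ge0// ltrDl.
Qed.

Lemma expmx0 : expmx (0 : 'M[R]_d) = 1%:M.
Proof.
apply: cvg_lim; first exact: norm_hausdorff.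
apply: cvg_near_cst; exists 1%N => // -[//|n] _.
rewrite /series/= big_nat_recl//= big1_seq ?addr0; last first.
  by move=> k _; rewrite exprS mul0r scaler0.
by rewrite fact0 invr1 scale1r.
Qed.

End Exponential.

(** * Norm decrease along the flow *)

Section LinearFlow.
Context {R : realType} {d : nat}.
Variables (A : 'M[R]_d) (s0 : R).

Lemma is_derive_expmx_entry t i j :
  is_derive t (1 : R) (fun s => expmx ((s - s0) *: A) i j)
    ((A *m expmx ((t - s0) *: A)) i j).
Proof.
have := @is_derive_mul_expmx _ _ A 1%:M (t - s0) i j.
under eq_fun do rewrite mul1mx.
rewrite mul1mx => dE.
rewrite -[X in is_derive _ _ _ X]mulr1.
exact: (@is_derive1_comp _ _ (shift (- s0)) t _ _ dE (is_derive_shift _ _ _)).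
Qed.

Lemma continuous_expmx : continuous (fun s => expmx ((s - s0) *: A)).
Proof.
move=> t; apply/cvg_mxP => i j.
have [/derivable1_diffP/differentiable_continuous cE _] :=
  is_derive_expmx_entry t i j.
exact: cE.
Qed.

Lemma is_derive_flow (x : 'cV[R]_d) t i :
  is_derive t (1 : R) (fun s => (expmx ((s - s0) *: A) *m x) i 0)
    ((A *m (expmx ((t - s0) *: A) *m x)) i 0).
Proof.
rewrite mulmxA.
have -> : (fun s => (expmx ((s - s0) *: A) *m x) i 0) =
    \sum_(j < d) (fun s => expmx ((s - s0) *: A) i j * x j 0).
  by apply/funext => s; rewrite mxE fct_sumE.
rewrite mxE; apply: is_derive_sum => j.
have dE := is_derive_expmx_entry t i j.
have dc := is_derive_cst (x j 0) t (1 : R).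
have := is_deriveM dE dc; rewrite scaler0 add0r.
rewrite (_ : cst (x j 0) t *: _ = (A *m expmx ((t - s0) *: A)) i j * x j 0) //.
by rewrite /GRing.scale/= mulrC.
Qed.

(** The derivative of |y|^2 along y' = Ay is y^T (A^T + A) y. *)
Lemma norm_flow_nonincreasing (x : 'cV[R]_d) :
  sym_nonpos (A^T + A) ->
  {homo (fun s => let y := expmx ((s - s0) *: A) *m x in (y^T *m y) 0 0)
     : s t /~ s <= t}.
Proof.
move=> [_ Aneg] t s st.
pose v i : R -> R := fun s => (expmx ((s - s0) *: A) *m x) i 0.
pose f : R -> R := \sum_(i < d) (v i ^+ 2).
have fE r : ((expmx ((r - s0) *: A) *m x)^T *m (expmx ((r - s0) *: A) *m x)) 0 0
    = f r.
  by rewrite /f fct_sumE mxE; apply: eq_bigr => i _; rewrite mxE.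
have df r : is_derive r (1 : R) f
    (quad_form (A^T + A) (expmx ((r - s0) *: A) *m x)).
  set y := expmx _ *m x.
  apply: is_derive_eq.
    apply: is_derive_sum => i; apply: is_deriveX; exact: is_derive_flow.
  rewrite /v -/y; move: (y) => z.
  rewrite /quad_form mulmxDr mulmxDl -trmx_mul -mulmxA mxE ![in RHS]mxE -big_split/=.
  apply: eq_bigr => i _; rewrite !mxE expr1 /GRing.scale/=.
  ring.
rewrite /= !fE.
have fc : {within `[s, t], continuous f}.
  apply: derivable_within_continuous => r _.
  by case: (df r).
have fd (r : R) : r \in `]s, t[%R -> derivable f r 1 by move=> _; case: (df r).
have fneg (r : R) : r \in `]s, t[%R -> derive1 f r <= 0.
  by move=> _; rewrite derive1E; have [_ ->] := df r; exact: Aneg.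
by apply: (ler0_derive1_le_cc fd fneg fc); rewrite ?in_itv/= ?lexx ?st.
Qed.

End LinearFlow.

Section Switched.
Context {R : realType} {d p : nat}.
Variables (B : 'I_p -> 'M[R]_d) (u : input R p).
Let a := switch_time u.
Let Phi := fundamental_matrix B u.

(** At the right endpoint the formula of the next interval starts with exp(0),
    so both formulas agree there. *)
Lemma fundamental_matrix_closed n t : a n <= t <= a n.+1 ->
  Phi t = expmx ((t - a n) *: B (mode u n)) *m fundamental_at_switch B u n.
Proof.
move=> /andP[ant]; rewrite le_eqVlt => /predU1P[->|tan]; last first.
  by rewrite /Phi (@fundamental_matrixE _ _ _ B u n)// ant.
rewrite /Phi (@fundamental_matrixE _ _ _ B u n.+1) ?lexx ?switch_time_lt//.
by rewrite subrr scale0r expmx0 mul1mx.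
Qed.

(** A positive switching time is the right end of one closed interval of constant
    mode and the left end of the next. *)
Lemma fundamental_matrix_continuous t : 0 < t -> {for t, continuous Phi}.
Proof.
move=> t0; apply/left_right_continuousP.
have [m /andP[amt tam]] := switch_index_exists u (ltW t0).
have piece n : continuous (fun s =>
    expmx ((s - a n) *: B (mode u n)) *m fundamental_at_switch B u n).
  by move=> s; apply: cvg_mulmx; [exact: continuous_expmx|exact: cvg_cst].
split; last first.
  rewrite (fundamental_matrix_closed (n := m)) ?amt ?ltW//.
  apply: cvg_trans (cvg_at_right_filter (piece m t)); apply: near_eq_cvg.
  near=> s; rewrite (fundamental_matrix_closed (n := m))//.
  apply/andP; split; last by near: s; exact: nbhs_right_le.
  by apply: (le_trans amt); near: s; exact: nbhs_right_ge.
have [n ant tan] : exists2 n, a n < t & t <= a n.+1.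
  move: amt; rewrite le_eqVlt => /predU1P[amt|amt]; last by exists m => //; exact: ltW.
  case: m tam amt => [|n] tam amt; first by move: t0; rewrite -amt /a switch_time0 ltxx.
  by exists n; rewrite -amt// switch_time_lt.
rewrite (fundamental_matrix_closed (n := n)) ?(ltW ant)//.
apply: cvg_trans (cvg_at_left_filter (piece n t)); apply: near_eq_cvg.
near=> s; rewrite (fundamental_matrix_closed (n := n))//.
apply/andP; split; first by near: s; exact: nbhs_left_ge.
by apply: le_trans tan; near: s; exact: nbhs_left_le.
Unshelve. all: by end_near. Qed.

Lemma gram_nonincreasing (x : 'cV[R]_d) s t :
  (forall i, sym_nonpos ((B i)^T + B i)) -> 0 <= s -> s <= t ->
  quad_form ((Phi t)^T *m Phi t) x <= quad_form ((Phi s)^T *m Phi s) x.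
Proof.
move=> hB.
have piece n s' t' : a n <= s' -> s' <= t' -> t' <= a n.+1 ->
    quad_form ((Phi t')^T *m Phi t') x <= quad_form ((Phi s')^T *m Phi s') x.
  move=> as' st ta; rewrite !quad_form_gram.
  rewrite (fundamental_matrix_closed (n := n) (t := s')) ?as' ?(le_trans st)//.
  rewrite (fundamental_matrix_closed (n := n) (t := t')) ?ta ?(le_trans as')//.
  have := norm_flow_nonincreasing (a n) (fundamental_at_switch B u n *m x)
    (hB (mode u n)) st.
  by rewrite /= !mulmxA.
have upto n s' t' : 0 <= s' -> s' <= t' -> t' <= a n ->
    quad_form ((Phi t')^T *m Phi t') x <= quad_form ((Phi s')^T *m Phi s') x.
  elim: n s' t' => [|n ih] s' t' s0 st ta.
    suff -> : t' = s' by []; apply/eqP; rewrite eq_le st andbT.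
    by apply: le_trans ta _; rewrite /a switch_time0.
  have [tan|/ltW ant] := leP t' (a n); first exact: ih.
  have [ans|/ltW san] := leP (a n) s'; first exact: (piece n).
  by apply: le_trans (piece n _ _ (lexx _) ant ta) (ih _ _ s0 san (lexx _)).
move=> s0 st.
have [n /andP[_ /ltW tn]] := switch_index_exists u (le_trans s0 st).
exact: (upto n.+1).
Qed.

(** Monotonicity gives the convergence of each quadratic form, and the entries
    of a symmetric matrix are combinations of values of its quadratic form. *)
Lemma gram_cvg : (forall i, sym_nonpos ((B i)^T + B i)) ->
  exists L : 'M[R]_d, (Phi t)^T *m Phi t @[t --> +oo] --> L.
Proof.
move=> hB.
pose G t := (Phi t)^T *m Phi t.
have lim (x : 'cV[R]_d) : exists l : R, quad_form (G t) x @[t --> +oo] --> l.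
  (* extended by its value at 0, g is monotone on the whole line *)
  pose g : R -> R := fun t => - quad_form (G (Num.max t 0)) x.
  have gnd : {homo g : s t / s <= t}.
    move=> s t st; rewrite /g lerN2; apply: gram_nonincreasing => //.
      by rewrite le_max lexx orbT.
    by rewrite ge_max !le_max st lexx !orbT.
  have gub : has_ubound (range g).
    exists 0 => _ [t _ <-]; rewrite /g oppr_le0 quad_form_gram.
    exact: norm_col_ge0.
  exists (- sup (range g)).
  apply: cvg_trans (cvgN (nondecreasing_cvgr gnd gub)); apply: near_eq_cvg.
  by near=> t; rewrite /g opprK max_l.
have [l lP] := choice lim.
pose e (i : 'I_d) : 'cV[R]_d := delta_mx i 0.
have ee (Q : 'M[R]_d) i j : ((e i)^T *m Q *m e j) 0 0 = Q i j.
  by rewrite /e trmx_delta -rowE -colE !mxE.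
have polar (Q : 'M[R]_d) i j : symmetric_mx Q ->
    Q i j = (quad_form Q (e i + e j) - quad_form Q (e i) - quad_form Q (e j)) / 2.
  move=> Qs; have Qji : Q j i = Q i j by rewrite -[in RHS]Qs mxE.
  rewrite quad_formD [(_ *m e j + _) _ _]mxE !ee Qji.
  by field.
exists (\matrix_(i, j) ((l (e i + e j) - l (e i) - l (e j)) / 2)).
apply/cvg_mxP => i j; rewrite mxE.
have Gsym t : symmetric_mx (G t) by rewrite /symmetric_mx trmx_mul trmxK.
under eq_cvg do rewrite (polar _ i j (Gsym _)).
by apply: cvgMl; apply: cvgB; [apply: cvgB|]; exact: lP.
Unshelve. all: by end_near. Qed.

End Switched.

(** * The omega-limit set of the switched system *)

Theorem theorem1 (R : realType) (d p : nat) (B : 'I_p -> 'M[R]_d)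
    (hB : forall i, sym_nonpos ((B i)^T + B i))
    (u : input R p) (O S : R -> 'M[R]_d)
    (hOS : forall t, 0 <= t ->
      polar_decomposition (fundamental_matrix B u t) (O t) (S t)) :
  let Phi := fundamental_matrix B u in
  let Omega := omega_limit Phi in
  let OmegaO := omega_limit O in
  exists Su : 'M[R]_d,
  [/\ (* (a) *)
      [/\ forall t, 0 <= t -> (Phi t)^T *m Phi t = S t *m S t,
          (Phi t)^T *m Phi t @[t --> +oo] --> Su *m Su,
          sym_nonneg Su,
          Omega !=set0 &
          forall M, Omega M ->
            forall T, nonneg_sqrt (M^T *m M) T <-> T = Su],
      (* (b) *)
      [/\ compact OmegaO, connected OmegaO, OmegaO `<=` SO d &
          Omega = [set Q *m Su | Q in OmegaO]]
    & (* (c) *)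
      asymptotically_stable B u <-> Su = 0].
Proof.
move=> Phi Omega OmegaO.
have near0 : \forall t \near (+oo : set_system R), 0 <= t.
  by apply: nbhs_pinfty_ge; exact: num_real.
have nearSO : \forall t \near +oo, SO d (O t).
  by apply: filterS near0 => t /hOS[].
have gramE t : 0 <= t -> (Phi t)^T *m Phi t = S t *m S t.
  by move=> /hOS/polar_gram.
have [L PhiL] := gram_cvg u hB.
have Spsd : \forall t \near +oo, sym_nonneg (S t).
  by apply: filterS near0 => t /hOS[_ _ /posdef_nonneg].
have SSL : S t *m S t @[t --> +oo] --> L.
  apply: cvg_trans PhiL; apply: near_eq_cvg.
  by apply: filterS near0 => t /gramE ->.
have [Su [Su_psd SuSu SSu]] := psd_sqrt_cvg Spsd SSL.
have Phi_lim G (Q : 'M[R]_d) : UltraFilter G -> (+oo : set_system R) `<=` G ->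
    O @ G --> Q -> Phi @ G --> Q *m Su.
  move=> UG ooG OQ.
  apply: cvg_trans (cvg_mulmx OQ (cvg_trans (cvg_app S ooG) SSu)).
  by apply: near_eq_cvg; apply: ooG; apply: filterS near0 => t /hOS[].
have O_lim G : UltraFilter G -> (+oo : set_system R) `<=` G ->
    exists Q : 'M[R]_d, O @ G --> Q.
  move=> UG ooG.
  by have [Q _ OQ] := ultra_cvg UG (@compact_SO R d) (ooG _ nearSO); exists Q.
have OmegaO_SO : OmegaO `<=` SO d.
  move=> Q /omega_limit_ultra[G UG [ooG OQ]].
  exact: closed_SO_cvg (ooG _ nearSO) OQ.
have in_omega (f : R -> 'M[R]_d) G M : UltraFilter G ->
    (+oo : set_system R) `<=` G -> f @ G --> M -> omega_limit f M.
  by move=> UG ooG fM; rewrite omega_limitE; exact: cvg_sub_cluster ooG fM.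
have OmegaE : Omega = [set Q *m Su | Q in OmegaO].
  apply/seteqP; split=> M.
    move=> /omega_limit_ultra[G UG [ooG PhiM]].
    have [Q OQ] := O_lim G UG ooG; exists Q; first exact: in_omega OQ.
    exact: mx_cvg_unique (Phi_lim G Q UG ooG OQ) PhiM.
  move=> [Q /omega_limit_ultra[G UG [ooG OQ]] <-].
  exact: in_omega (Phi_lim G Q UG ooG OQ).
(* some ultrafilter goes to infinity, so Omega is nonempty *)
have [G0 [UG0 ooG0]] := ultraFilterLemma (@proper_pinfty_nbhs R).
exists Su; split.
- split=> //; first by rewrite SuSu.
    have [Q OQ] := O_lim G0 UG0 ooG0; exists (Q *m Su).
    exact: in_omega (Phi_lim G0 Q UG0 ooG0 OQ).
  move=> M; rewrite OmegaE => -[Q /OmegaO_SO[QQ _] <-] T.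
  have -> : (Q *m Su)^T *m (Q *m Su) = Su *m Su.
    by rewrite trmx_mul Su_psd.1 -mulmxA (mulmxA Q^T) QQ mul1mx.
  by split=> [[Tpsd TT]|->//]; apply: psd_sqrt_unique.
- split=> //.
    apply: (subclosed_compact _ (@compact_SO R d) OmegaO_SO).
    by rewrite /OmegaO omega_limitE; exact: closed_cluster.
  rewrite /OmegaO omega_limitE; apply: (connected_cluster (@compact_SO R d)).
    by move=> t /ltW/hOS[].
  move=> t t0; apply: (@polar_factor_continuous _ _ _ Phi O S t).
    near=> s; apply: hOS; apply: ltW; near: s; exact: lt_nbhsr.
  exact: fundamental_matrix_continuous.
- split=> [stable|Su0 a x].
    have Phi0 : Phi @ +oo --> (0 : 'M[R]_d).
      apply/cvg_mxP => i j; rewrite mxE.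
      have /cvg_mxP/(_ i 0) := stable (delta_mx j 0); rewrite mxE.
      by under eq_cvg do rewrite -colE mxE; apply.
    have L0 : L = 0.
      by rewrite (mx_cvg_unique PhiL (cvg_mulmx (cvg_trmx Phi0) Phi0)) mulmx0.
    apply: psd_sqrt_unique => //; last by rewrite SuSu L0 mulmx0.
    by split=> [|y]; [rewrite /symmetric_mx trmx0|rewrite /quad_form mulmx0 mul0mx mxE].
  apply: (@cvg_ultra R 'cV[R]_d +oo (fun t => Phi t *m x) 0) => G UG ooG.
  have [Q OQ] := O_lim G UG ooG.
  rewrite -(mul0mx _ x) -(mulmx0 _ Q) -Su0.
  exact: cvg_mulmx (Phi_lim G Q UG ooG OQ) (cvg_cst x).
Unshelve. all: by end_near. Qed.
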